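(* Let $n>1$ be an integer, let $K$ be an arbitrary group of order $n$ with identity element $e_K$, and let $H=S_2\wr K$ be the wreath product, whose elements are the triples $(g;k_1,k_2)$ with $g\in S_2$, $k_1,k_2\in K$, with multiplication $(g;k_1,k_2)(g';k'_1,k'_2)=(gg';\,k_1k'_{1^g},\,k_2k'_{2^g})$. Let $e$ denote the identity of $S_2$ and $\pi=(1,2)$ the transposition in $S_2$, and put $$A=\{(e;u,u): u\in K,\ u\neq e_K\},\quad B=\{(e;e_K,u): u\in K,\ u\neq e_K\},\quad C=\{(\pi;u,e_K): u\in K\}.$$ Let $X=A\cup B\cup C$. Then the Cayley digraph $\mathrm{Cay}(H,X)$ is a directed strongly regular graph with parameter set $(2n^2,\,3n-2,\,2n-1,\,n-1,\,3)$.
   Context: $S_2$ is the symmetric group on $\{1,2\}$, and $1^g,2^g$ denote the images of $1,2$ under $g\in S_2$. For a finite group $H$ and a subset $X\subseteq H$ not containing the identity, the Cayley digraph $\mathrm{Cay}(H,X)$ has vertex set $H$ and dart (arc) set $\{(x,y): x,y\in H,\ yx^{-1}\in X\}$. A directed strongly regular graph (DSRG) with parameter set $(N,k,t,\lambda,\mu)$ (in this order) is a loopless directed graph on $N$ vertices that is regular of valency $k$ (every vertex has in-degree and out-degree $k$), such that every vertex is incident with exactly $t$ undirected edges (an undirected edge is a pair of opposite arcs), and for any two distinct vertices $x,y$ the number of directed paths of length 2 from $x$ to $y$ is $\lambda$ if there is an arc from $x$ to $y$ and $\mu$ otherwise. Equivalently, its adjacency matrix $A$ (with zero diagonal) satisfies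 $AJ=JA=kJ$ and $A^2=tI+\lambda A+\mu(J-I-A)$, where $J$ is the all-one matrix and $I$ the identity matrix. *)

(* Defs.v *)
From HB Require Import structures.
From mathcomp Require Import all_boot all_fingroup.

Set Implicit Arguments.
Unset Strict Implicit.
Unset Printing Implicit Defensive.

Import GroupScope.

(* A directed graph on a finite vertex set is given by its arc relation.      *)
(* An undirected edge at x is a pair of opposite arcs, so it is counted by    *)
(* its other endpoint; a directed path x -> z -> y is counted by its middle   *)
(* vertex z.                                                                  *)
Record dsrg (V : finType) (arc : rel V) (N k t lambda mu : nat) : Prop := DSRG {
  dsrg_order : #|V| = N;
  dsrg_loopless : irreflexive arc;
  dsrg_outdegree : forall x : V, #|[set y | arc x y]| = k;
  dsrg_indegree : forall x : V, #|[set y | arc y x]| = k;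
  dsrg_undirected : forall x : V, #|[set y | arc x y && arc y x]| = t;
  dsrg_paths2 : forall x y : V, x != y ->
    #|[set z | arc x z && arc z y]| = if arc x y then lambda else mu }.

(* No condition 1 \notin X is imposed here: it amounts to looplessness.       *)
Definition cayley (H : finGroupType) (X : {set H}) : rel H :=
  fun x y => y * x^-1 \in X.

(* The points 1 and 2 on which S_2 acts are the elements 0 and 1 of 'I_2.     *)
Definition pt1 : 'I_2 := ord0.
Definition pt2 : 'I_2 := ord_max.

(* Wr g k1 k2 is the triple (g; k1, k2). A fresh record is used because       *)
(* 'S_2 * K * K already carries the direct product group structure.           *)
Record wreath_S2 (K : finGroupType) := Wr {
  wr_top : 'S_2;
  wr_fst : K;
  wr_snd : K }.

Section WreathGroup.

Variable K : finGroupType.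
Implicit Types x y z : wreath_S2 K.

Definition wr_to_prod x : 'S_2 * K * K := (wr_top x, wr_fst x, wr_snd x).
Definition wr_of_prod (p : 'S_2 * K * K) : wreath_S2 K :=
  Wr p.1.1 p.1.2 p.2.

Lemma wr_to_prodK : cancel wr_to_prod wr_of_prod.
Proof. by case. Qed.

HB.instance Definition _ := Finite.copy (wreath_S2 K) (can_type wr_to_prodK).

Definition wr_coord x (i : 'I_2) : K := if i == pt1 then wr_fst x else wr_snd x.

(* With MathComp's convention (g * g') i = g' (g i), permutations act on the  *)
(* right, so g i is the image i^g.                                            *)
Definition wr_mul x y : wreath_S2 K :=
  Wr (wr_top x * wr_top y)
     (wr_fst x * wr_coord y (wr_top x pt1))
     (wr_snd x * wr_coord y (wr_top x pt2)).

Definition wr_one : wreath_S2 K := Wr 1 1 1.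

Definition wr_inv x : wreath_S2 K :=
  Wr (wr_top x)^-1
     (wr_coord x ((wr_top x)^-1 pt1))^-1
     (wr_coord x ((wr_top x)^-1 pt2))^-1.

Lemma wr_ext x y :
  wr_top x = wr_top y -> wr_coord x =1 wr_coord y -> x = y.
Proof.
case: x y => [g a b] [h c d] /= -> E; congr Wr; first exact: (E pt1).
exact: (E pt2).
Qed.

Lemma wr_coord_mul x y i :
  wr_coord (wr_mul x y) i = wr_coord x i * wr_coord y (wr_top x i).
Proof.
rewrite {1 2}/wr_coord; case: eqP => [-> // | /eqP i1].
by suff -> : i = pt2 by []; apply: val_inj; case: i i1 => -[|[|]].
Qed.

Lemma wr_coord_inv x i :
  wr_coord (wr_inv x) i = (wr_coord x ((wr_top x)^-1 i))^-1.
Proof.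
rewrite {1}/wr_coord; case: eqP => [-> // | /eqP i1].
by suff -> : i = pt2 by []; apply: val_inj; case: i i1 => -[|[|]].
Qed.

Lemma wr_coord_one i : wr_coord wr_one i = 1.
Proof. by rewrite /wr_coord; case: ifP. Qed.

Lemma wr_mulA : associative wr_mul.
Proof.
move=> x y z; apply: wr_ext => [|i]; first by rewrite /= mulgA.
by rewrite !wr_coord_mul /= permM mulgA.
Qed.

Lemma wr_mul1 : left_id wr_one wr_mul.
Proof.
move=> x; apply: wr_ext => [|i]; first by rewrite /= mul1g.
by rewrite wr_coord_mul wr_coord_one /= perm1 mul1g.
Qed.

Lemma wr_mulV : left_inverse wr_one wr_inv wr_mul.
Proof.
move=> x; apply: wr_ext => [|i]; first by rewrite /= mulVg.
by rewrite wr_coord_mul wr_coord_inv wr_coord_one /= mulVg.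
Qed.

HB.instance Definition _ :=
  Finite_isGroup.Build (wreath_S2 K) wr_mulA wr_mul1 wr_mulV.

Definition conn_A : {set wreath_S2 K} := [set Wr 1 u u | u : K & u != 1].
Definition conn_B : {set wreath_S2 K} := [set Wr 1 1 u | u : K & u != 1].
Definition conn_C : {set wreath_S2 K} := [set Wr (tperm pt1 pt2) u 1 | u : K].

End WreathGroup.

Arguments conn_A : clear implicits.
Arguments conn_B : clear implicits.
Arguments conn_C : clear implicits.

(* Main.v *)
Require Import Defs.
From mathcomp Require Import all_boot all_fingroup.
From mathcomp Require Import zify.

Set Implicit Arguments.
Unset Strict Implicit.
Unset Printing Implicit Defensive.

(* The 2-paths from x to y correspond to the factorizations y x^-1 = b a with *)
(* a, b in X. Fix w = y x^-1 and let a, given by u : K, range over one of the *)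
(* three parts of X: the condition w a^-1 \in X then holds for at most two    *)
(* prescribed values of u, or for no u, or for all u but at most one, and     *)
(* adding the three counts gives t, lambda or mu according to w.              *)

(** Out- and in-neighbours of [x] form the translates [X x] and [X^-1 x], so both degrees equal
    [#|X|]. Membership in [X] depends only on coordinate equations ([conn_base], [conn_swap]), so
    each part of the 2-path count is a sum of indicators of [u == v] or its negation. The totals are
    in [conn_square_base] and [conn_square_swap], and [t] is the count at [w = 1]. *)

Section CayleyCounts.

Local Open Scope group_scope.

Variables (H : finGroupType) (X : {set H}).

Lemma card_cayley_out x : #|[set y | cayley X x y]| = #|X|.
Proof.
rewrite -(card_imset X (mulIg x)); apply: eq_card => y; rewrite inE /cayley.
apply/idP/imsetP => [yX | [a aX ->]]; last by rewrite mulgK.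
by exists (y * x^-1); rewrite ?mulgKV.
Qed.

Lemma card_cayley_in x : #|[set y | cayley X y x]| = #|X|.
Proof.
have inj : injective (fun a => a^-1 * x) by move=> a b /mulIg /invg_inj.
rewrite -(card_imset X inj); apply: eq_card => y; rewrite inE /cayley.
apply/idP/imsetP => [yX | [a aX ->]]; last by rewrite invMg invgK mulKVg.
by exists (x * y^-1); rewrite // invMg invgK mulgKV.
Qed.

(** Write the middle vertex as [z = a * x]. The case [x = y] is allowed and counts undirected edges
    at [x]. *)
Lemma card_cayley_paths2 x y :
  #|[set z | cayley X x z && cayley X z y]|
  = \sum_(a in X) (y * x^-1 * a^-1 \in X)%g.
Proof.
rewrite -sum1_card (reindex_inj (mulIg x)) -big_mkcondr.
by apply: eq_bigl => a; rewrite !inE /cayley mulgK invMg mulgA.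
Qed.

End CayleyCounts.

Section IndicatorSums.

Variables (T : finType) (P : pred T).

Lemma sum_indic_eq v : \sum_(u | P u) (u == v) = P v.
Proof.
case: (boolP (P v)) => Pv.
  by rewrite (bigD1 v) //= eqxx big1 // => u /andP[_ /negPf->].
by rewrite big1 // => u Pu; case: eqP Pu Pv => // -> ->.
Qed.

Lemma sum_indic_neq v : \sum_(u | P u) (u != v) = #|P| - P v.
Proof.
rewrite -sum_indic_eq -sum1_card -sumnB; last by move=> u; case: eqP.
by apply: eq_bigr => u _; case: eqP.
Qed.

End IndicatorSums.

Lemma S2_cases (g : 'S_2) : g = 1%g \/ g = tperm pt1 pt2.
Proof.
have I2 (i : 'I_2) : i = pt1 \/ i = pt2.
  by case: i => -[|[|//]] ?; [left | right]; apply: val_inj.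
have neq : g pt1 != g pt2 by rewrite (inj_eq perm_inj).
case: (I2 (g pt1)) (I2 (g pt2)) neq => g1 [] g2; rewrite g1 g2 // => _;
  [left | right]; apply/permP => i; case: (I2 i) => ->;
  by rewrite ?perm1 ?tpermL ?tpermR.
Qed.

Section ConnectionSet.

Local Open Scope group_scope.

Variable K : finGroupType.
Implicit Types (p q u : K) (w : wreath_S2 K).

Local Notation swap := (tperm pt1 pt2).
Local Notation X := (conn_A K :|: conn_B K :|: conn_C K).

Lemma swap_neq1 : (1 : 'S_2) <> swap.
Proof. by move/permP/(_ pt1); rewrite perm1 tpermL. Qed.

Lemma card_wreath_S2 : #|{: wreath_S2 K}| = (2 * #|K| ^ 2)%N.
Proof.
rewrite -(card_imset predT (can_inj (@wr_to_prodK K))).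
have -> : wr_to_prod (K:=K) @: predT = setT.
  by apply/setP => -[[g a] b]; rewrite inE; apply/imsetP; exists (Wr g a b).
by rewrite cardsT !card_prod card_Sn expnS expn1 mulnA.
Qed.

(** In [w = c * d] the top of [c] permutes the coordinates of [d]; hence, here and in the next three
    lemmas, the divisor's coordinates are exchanged exactly when the quotient has top [swap]. *)
Lemma wr_div11 p q a b :
  Wr 1 p q * (Wr 1 a b)^-1 = Wr 1 (p * a^-1) (q * b^-1).
Proof.
apply: (canLR (mulgK _)); congr Wr; rewrite /= ?mulg1 //.
  by rewrite perm1 mulgKV.
by rewrite perm1 mulgKV.
Qed.

Lemma wr_divs1 p q a b :
  Wr swap p q * (Wr 1 a b)^-1 = Wr swap (p * b^-1) (q * a^-1).
Proof.
apply: (canLR (mulgK _)); congr Wr; rewrite /= ?mulg1 //.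
  by rewrite tpermL mulgKV.
by rewrite tpermR mulgKV.
Qed.

Lemma wr_div1s p q a b :
  Wr 1 p q * (Wr swap a b)^-1 = Wr swap (p * b^-1) (q * a^-1).
Proof.
apply: (canLR (mulgK _)); congr Wr; rewrite /= ?tperm2 //.
  by rewrite tpermL mulgKV.
by rewrite tpermR mulgKV.
Qed.

Lemma wr_divss p q a b :
  Wr swap p q * (Wr swap a b)^-1 = Wr 1 (p * a^-1) (q * b^-1).
Proof.
apply: (canLR (mulgK _)); congr Wr; rewrite /= ?mul1g //.
  by rewrite perm1 mulgKV.
by rewrite perm1 mulgKV.
Qed.

(* A requires p = q != 1 and B requires p = 1 != q: exactly one of the two    *)
(* equations p = q and p = 1 holds.                                           *)
Lemma conn_base p q : (Wr 1 p q \in X) = (p == q) (+) (p == 1).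
Proof.
rewrite !inE; apply/orP/idP => [[/orP[]|] /imsetP[u] |].
- by rewrite inE => u1 [-> ->]; rewrite eqxx (negPf u1).
- by rewrite inE => u1 [-> ->]; rewrite eqxx (eq_sym 1) (negPf u1).
- by move=> _ [/swap_neq1].
case: (eqVneq p q) => [<- | pq]; case: (eqVneq p 1) => [p1 | p1] //= _; left.
  by apply/orP; left; apply/imsetP; exists p; rewrite ?inE.
by apply/orP; right; apply/imsetP; exists q; rewrite ?p1 // inE -p1 eq_sym.
Qed.

Lemma conn_swap p q : (Wr swap p q \in X) = (q == 1).
Proof.
rewrite !inE; apply/orP/eqP => [[/orP[]|] /imsetP[u] | ->].
- by move=> _ [/esym/swap_neq1].
- by move=> _ [/esym/swap_neq1].
- by move=> _ [].
by right; apply/imsetP; exists p.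
Qed.

(** The first coordinate separates A from B, the top component separates C from both, and each
    parametrization by [u] is injective. *)
Lemma sum_conn (F : wreath_S2 K -> nat) :
  \sum_(a in X) F a = (\sum_(u | u != 1%g) F (Wr 1%g u u)
    + \sum_(u | u != 1%g) F (Wr 1%g 1%g u) + \sum_u F (Wr swap u 1%g))%N.
Proof.
have dAB : [disjoint conn_A K & conn_B K].
  rewrite disjoint_subset; apply/subsetP => w /imsetP[u]; rewrite !inE => u1 ->.
  by apply/imsetP => -[v _ [/eqP]]; rewrite (negPf u1).
have dABC : [disjoint conn_A K :|: conn_B K & conn_C K].
  rewrite disjoint_subset; apply/subsetP => w; rewrite !inE.
  by case/orP=> /imsetP[u _ ->]; apply/imsetP => -[v _ [/swap_neq1]].
have bigSU (A B : {set wreath_S2 K}) : [disjoint A & B] ->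
    \sum_(a in A :|: B) F a = (\sum_(a in A) F a + \sum_(a in B) F a)%N.
  by move=> dis; rewrite -bigU //; apply: eq_bigl => a; rewrite !inE.
rewrite !bigSU //.
rewrite !big_imset /=; try by move=> u v _ _ [].
by congr (_ + _ + _); apply: eq_bigl => u; rewrite inE.
Qed.

Hypothesis K_gt1 : 1 < #|K|.

Lemma card_neq1 : #|[pred u : K | u != 1]| = (#|K| - 1)%N.
Proof. by rewrite subn1 -(cardC1 (1 : K)); apply: eq_card. Qed.

Lemma card_conn : #|X| = (3 * #|K| - 2)%N.
Proof.
rewrite -sum1_card sum_conn !sum1_card card_neq1 -[#|xpredT|]/#|K|.
lia.
Qed.

Lemma mulV_eq p q u : (p * u^-1 == q) = (u == q^-1 * p).
Proof.
by rewrite -(inj_eq (mulIg u)) mulgKV -(inj_eq (mulgI q^-1)) mulKg eq_sym.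
Qed.

Lemma conn_square_base p q :
  \sum_(a in X) (Wr 1 p q * a^-1 \in X)%g =
  if (p == 1) && (q == 1) then (2 * #|K| - 1)%N
  else if Wr 1 p q \in X then (#|K| - 1)%N else 3.
Proof.
rewrite sum_conn.
under eq_bigr => u _ do
  rewrite wr_div11 conn_base (inj_eq (mulIg _)) -eq_mulgV1 (eq_sym p u).
under [X in (_ + X + _)%N]eq_bigr => u _ do
  rewrite wr_div11 conn_base invg1 mulg1 (eq_sym p (_ * _)) mulV_eq addbC.
under [X in (_ + X)%N]eq_bigr => u _ do
  rewrite wr_div1s conn_swap -eq_mulgV1 (eq_sym q).
rewrite sum_indic_eq conn_base; have := K_gt1.
(* C always contributes 1, at [u = q]. With n the order of [K], A and B contribute n-1 and n-1 if p
   = q = 1; n-2 and 0 if p = q != 1; 0 and n-2 if p = 1 != q; 1 and 1 otherwise, since then p^-1 q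
   != 1. *)
case: (eqVneq p q) => [<- | pq]; case: (eqVneq p 1) => [p1 | p1] /=;
  rewrite ?p1 ?mulVg ?invg1 ?mul1g ?sum_indic_eq ?sum_indic_neq ?card_neq1;
  rewrite ?eqxx ?p1 /=.
- lia.
- lia.
- by rewrite -p1 eq_sym (negPf pq) /=; lia.
- by rewrite -eq_mulVg1 pq.
Qed.

Lemma conn_square_swap p q :
  \sum_(a in X) (Wr swap p q * a^-1 \in X)%g =
  if Wr swap p q \in X then (#|K| - 1)%N else 3.
Proof.
rewrite sum_conn conn_swap.
under eq_bigr => u _ do rewrite wr_divs1 conn_swap -eq_mulgV1 (eq_sym q).
under [X in (_ + X + _)%N]eq_bigr => u _ do
  rewrite wr_divs1 conn_swap invg1 mulg1.
under [X in (_ + X)%N]eq_bigr => u _ do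
  rewrite wr_divss conn_base invg1 mulg1 !mulV_eq.
rewrite invg1 mul1g sum_indic_eq; case: (eqVneq q 1) => [-> | q1].
  (* For q = 1 all of B counts; in C the two equations coincide and cancel. *)
  rewrite sum1_card card_neq1 invg1 mul1g big1 ?addn0 // => u _.
  by rewrite addbb.
(* For q != 1 the solutions q^-1 p and p differ, so the exclusive or is a sum: C gives 2, A gives 1,
   B nothing. *)
rewrite big1 // (eq_bigr (fun u => (u == q^-1 * p)%g + (u == p))) => [|u _].
  by rewrite big_split /= !sum_indic_eq.
case: (eqVneq u p) => [-> | _]; last by rewrite addbF addn0.
by rewrite -mulV_eq mulgV eq_sym (negPf q1).
Qed.

End ConnectionSet.

Theorem theorem3p2 (n : nat) (n_gt1 : 1 < n)
    (K : finGroupType) (K_order : #|K| = n) :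
  dsrg (cayley (conn_A K :|: conn_B K :|: conn_C K))
    (2 * n ^ 2) (3 * n - 2) (2 * n - 1) (n - 1) 3.
Proof.
rewrite -K_order in n_gt1 *.
have one : (1 : wreath_S2 K)%g = Wr 1 1 1 by [].
split=> [|x|x|x|x|x y].
- exact: card_wreath_S2.
- by rewrite /cayley mulgV one conn_base addbb.
- by rewrite card_cayley_out card_conn.
- by rewrite card_cayley_in card_conn.
(* An undirected edge at [x] is a 2-path from [x] to itself. *)
- by rewrite card_cayley_paths2 mulgV one conn_square_base // eqxx.
rewrite card_cayley_paths2 eq_sym eq_mulgV1 one /cayley.
case: (y * x^-1)%g => g p q; have [->|->] := S2_cases g => neq; last first.
  by rewrite conn_square_swap.
rewrite conn_square_base //; case: andP neq => // -[/eqP-> /eqP->].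
by rewrite eqxx.
Qed.
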